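(* Let $W_1,\dots,W_p$ be real-valued knockoff statistics for $p$ variables with set of nulls $\mathcal H_0\subseteq[p]$, satisfying the following property: the collection $\{\mathrm{sign}(W_j)\}_{j\in\mathcal H_0}$ is independent of the collection $\left(\{|W_j|\}_{j\in[p]},\{\mathrm{sign}(W_j)\}_{j\notin\mathcal H_0}\right)$, and the signs $\{\mathrm{sign}(W_j)\}_{j\in\mathcal H_0}$ are i.i.d. fair coin flips (positive or negative with probability $1/2$ each). Let $\pi$ be the ordering of $[p]$ obtained by sorting the $W_j$ by decreasing magnitude $|W_j|$, and define, for $k\in[p]$, $$\mathcal R_k\equiv\{\pi(j): j\le k,\ \mathrm{sign}(W_{\pi(j)})>0\}.$$ For $a>0$ and $\alpha\in(0,1)$ let $$\overline V_{\mathrm{knockoff}}(\mathcal R_k)\equiv\left\lfloor\frac{\log(\alpha^{-1})}{a\log(2-\alpha^{1/a})}\cdot\left(a+\left|\{j\le k:\mathrm{sign}(W_{\pi(j)})<0\}\right|\right)\right\rfloor,\qquad\overline{\mathrm{FDP}}_{\mathrm{knockoff}}(\mathcal R_k)\equiv\frac{\overline V_{\mathrm{knockoff}}(\mathcal R_k)}{|\mathcal R_k|}.$$ Then $$\Pr\left\{\mathrm{FDP}(\mathcal R_k)\le\overline{\mathrm{FDP}}_{\mathrm{knockoff}}(\mathcal R_k)\ \text{for all }k\in[p]\right\}\ge1-\alpha.$$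
   Context: $[p]=\{1,\dots,p\}$ and $\mathcal H_0$ is a fixed (nonrandom) subset. For $\mathcal R\subseteq[p]$, $\mathrm{FDP}(\mathcal R)\equiv|\mathcal R\cap\mathcal H_0|/|\mathcal R|$, with $\mathrm{FDP}(\varnothing)\equiv0$; when $\mathcal R_k=\varnothing$ the inequality $\mathrm{FDP}(\mathcal R_k)\le\overline{\mathrm{FDP}}_{\mathrm{knockoff}}(\mathcal R_k)$ is regarded as holding trivially. Ties in $|W_j|$ are broken by a fixed deterministic rule depending only on the magnitudes and the indices (e.g. by smallest index). $\lfloor\cdot\rfloor$ is the floor function and $\log$ the natural logarithm. *)

(* Defs.v *)
(* MathComp / MathComp-Analysis *)
From HB Require Import structures.
From mathcomp Require Import all_boot all_order all_algebra all_fingroup.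
From mathcomp Require Import all_classical all_reals all_analysis.

Set Implicit Arguments.
Unset Strict Implicit.
Unset Printing Implicit Defensive.

Import Order.TTheory GRing.Theory Num.Theory.
Import numFieldNormedType.Exports.

Local Open Scope classical_set_scope.
Local Open Scope ring_scope.

(* Generators of the sigma-algebra of the subcollection (X_i), i in D. *)
Definition family_events (T : Type) (R : realType) (I : Type)
    (X : I -> T -> R) (D : set I) : set (set T) :=
  \bigcup_(i in D) preimage_set_system setT (X i) measurable.

Definition independent_systems (d : measure_display) (T : measurableType d)
    (R : realType) (P : probability T R) (F G : set (set T)) : Prop :=
  forall A B : set T, F A -> G B -> P (A `&` B) = (P A * P B)%E.

Definition mutually_independent (d : measure_display) (T : measurableType d)
    (R : realType) (P : probability T R) (I : finType) (D : {set I})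
    (X : I -> T -> R) : Prop :=
  forall (J : {set I}) (B : I -> set R),
    J \subset D -> (forall i, measurable (B i)) ->
    P (\bigcap_(i in [set` J]) (X i @^-1` B i)) =
    (\prod_(i in J) P (X i @^-1` B i))%E.

Section knockoff_property.
Context (d : measure_display) (T : measurableType d) (R : realType).
Context (P : probability T R) (p : nat).

Definition sign_of (W : 'I_p -> {RV P >-> R}) (j : 'I_p) : T -> R :=
  fun x => Num.sg (W j x).

Definition magnitude_of (W : 'I_p -> {RV P >-> R}) (j : 'I_p) : T -> R :=
  fun x => `|W j x|.

(* A fair coin flip takes the values 1 and -1 with probability 1/2 each, so
   null statistics vanish with probability 0; the sign of a non-null
   statistic may be 0. *)
Definition knockoff_property (W : 'I_p -> {RV P >-> R}) (H0 : {set 'I_p}) :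
    Prop :=
  [/\ independent_systems P
        <<s family_events (sign_of W) [set j | j \in H0] >>
        <<s family_events (magnitude_of W) setT `|`
            family_events (sign_of W) [set j | j \notin H0] >>,
      mutually_independent P H0 (sign_of W) &
      forall j : 'I_p, j \in H0 ->
        P [set x | sign_of W j x = 1] = (2^-1)%:E /\
        P [set x | sign_of W j x = -1] = (2^-1)%:E].

End knockoff_property.

(* A rule turning a vector m of magnitudes into an ordering of the indices by
   decreasing magnitude. Ties may be resolved in any way that is a function of
   m; Borel measurability of the rule makes the resulting random ordering a
   random variable. *)
Definition ordering_rule (R : realType) (p : nat)
    (tau : p.-tuple R -> {perm 'I_p}) : Prop :=
  (forall (m : p.-tuple R) (i j : 'I_p),
     (i <= j)%N -> tnth m (tau m j) <= tnth m (tau m i)) /\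
  (forall s : {perm 'I_p}, measurable [set m : p.-tuple R | tau m = s]).

(* The ordinals j, k : 'I_p are zero-based positions, so that j <= k ranges
   over the first k.+1 positions. *)
Section path.
Context (R : realType) (p : nat).

Definition magnitude_ordering (tau : p.-tuple R -> {perm 'I_p})
    (w : 'I_p -> R) : {perm 'I_p} := tau [tuple `|w i| | i < p].

Definition selected (w : 'I_p -> R) (pi : {perm 'I_p}) (k : 'I_p) :
    {set 'I_p} :=
  [set pi j | j : 'I_p & (j <= k)%N && (0 < Num.sg (w (pi j)))]%SET.

Definition num_negative (w : 'I_p -> R) (pi : {perm 'I_p}) (k : 'I_p) : nat :=
  #|[set j : 'I_p | (j <= k)%N && (Num.sg (w (pi j)) < 0)]%SET|.

Definition Vbar_knockoff (a alpha : R) (w : 'I_p -> R) (pi : {perm 'I_p})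
    (k : 'I_p) : int :=
  Num.floor (ln alpha^-1 / (a * ln (2 - alpha `^ a^-1)) *
             (a + (num_negative w pi k)%:R)).

(* Division by 0 yields 0. Hence the FDP of the empty set is 0, and
   FDP <= FDPbar reads 0 <= 0 when the selected set is empty. *)
Definition FDP (H0 S : {set 'I_p}) : R := #|S :&: H0|%:R / #|S|%:R.

Definition FDPbar_knockoff (a alpha : R) (w : 'I_p -> R) (pi : {perm 'I_p})
    (k : 'I_p) : R :=
  (Vbar_knockoff a alpha w pi k)%:~R / #|selected w pi k|%:R.

End path.

(* Main.v *)
Require Import Defs.
From HB Require Import structures.
From mathcomp Require Import all_boot all_order all_algebra all_fingroup.
From mathcomp Require Import all_classical all_reals all_analysis.
From mathcomp Require Import measurable_realfun ring lra.
Set Implicit Arguments.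
Unset Strict Implicit.
Unset Printing Implicit Defensive.
Import Order.TTheory GRing.Theory Num.Theory.
Import numFieldNormedType.Exports.
Local Open Scope classical_set_scope.
Local Open Scope ring_scope.

(** Why the bound holds. Write v = alpha^(1/a) and u = 2 - v, so that
    0 < v < 1 < u and u + v = 2. A gambler who starts with wealth 1 walks
    through the nulls in decreasing order of magnitude, multiplying the wealth
    by u at a positive sign and by v at a negative one. The signs are fair
    coins, so the wealth u^V v^N, with V positive and N negative null signs
    seen so far, is a nonnegative martingale, and by Ville's inequality it ever
    reaches 1/alpha with probability at most alpha. As long as it stays below
    1/alpha, taking logarithms in u^V v^N < 1/alpha gives

      V < log(1/alpha) / (a log u) (a + N),

    and since V is an integer it is at most the floor of the right-hand side.
    Replacing N by the number of all negative signs only enlarges the bound,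
    and dividing by the size of the selected set gives the claim for every
    prefix at once ([FDP_le_bar]).

    Everything relevant takes finitely many values, so Ville's inequality is
    proved by counting: among the 2^n sign sequences of length n, at most
    alpha 2^n lead to a crossing ([sum_crosses_le]).
    The ordering is a function of the magnitudes, hence independent of the null
    signs; so each pair of an ordering s and a sign sequence t has probability
    P(ordering = s) 2^-n, and summing over the pairs whose sequence does not
    cross gives probability at least 1 - alpha
    ([probability_sign_patterns]). *)

(** * Ville's inequality for fair coin flips, by counting *)

Section coin_betting.
Context (R : realFieldType) (u v : R).
Hypotheses (u_gt0 : 0 < u) (v_gt0 : 0 < v) (uDv : u + v = 2).

(** The wealth after some prefix of bs reaches c. Instead of carrying the wealth
    along, each flip rescales the level still to be reached, so that an
    induction on bs sees the remaining game as a new game started at 1. *)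
Fixpoint crosses (c : R) (bs : seq bool) : bool :=
  (c <= 1) || (if bs is b :: bs' then crosses (c / (if b then u else v)) bs'
               else false).

Lemma crossesN_prefix (c : R) (b1 b2 : seq bool) : ~~ crosses c (b1 ++ b2) ->
  u ^+ count id b1 * v ^+ count negb b1 < c.
Proof.
elim: b1 c => [|b b1 IH] c /=.
  rewrite !expr0 mulr1 => nc; rewrite ltNge; apply: contra nc => c1.
  by case: b2 => [|? ?] /=; rewrite c1.
rewrite negb_or => /andP[_ /IH]; case: b => /=.
  by rewrite add1n add0n exprS ltr_pdivlMr// [X in X < c -> _]mulrC mulrA.
by rewrite add1n add0n exprS ltr_pdivlMr// -mulrA [X in _ * X]mulrC.
Qed.

Lemma sum_tupleS n (F : seq bool -> R) :
  \sum_(t : n.+1.-tuple bool) F t =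
  \sum_(t : n.-tuple bool) (F (true :: t) + F (false :: t)).
Proof.
pose h (x : n.-tuple bool * bool) : n.+1.-tuple bool := cons_tuple x.2 x.1.
rewrite (reindex h)/=; last first.
  exists (fun t => (behead_tuple t, thead t)) => [[t b] _|t _].
    by congr pair; apply: val_inj.
  by rewrite [RHS]tuple_eta; apply: val_inj.
rewrite -(pair_bigA _ (fun t b => F (h (t, b)))) /=.
by apply: eq_bigr => t _; rewrite big_bool.
Qed.

(** Ville's inequality: c times the number of crossing sequences is at most 2^n.
    For c <= 1 every sequence crosses at time 0 and the bound is trivial.
    Otherwise split on the first flip: the two halves are games with levels c/u
    and c/v, and c = u (c/u) = v (c/v) weighs the two inductive bounds by u and
    v, whose sum is 2. *)
Lemma sum_crosses_le n (c : R) : 0 <= c ->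
  c * \sum_(t : n.-tuple bool) (crosses c t)%:R <= 2 ^+ n.
Proof.
have trivial_bound m (e : R) : 0 <= e -> e <= 1 ->
    e * \sum_(t : m.-tuple bool) (crosses e t)%:R <= 2 ^+ m.
  move=> e0 e1; apply: (@le_trans _ _ (1 * \sum_(t : m.-tuple bool) 1)).
    by apply: ler_pM => //; [apply: sumr_ge0|apply: ler_sum => t _; case: crosses].
  by rewrite mul1r sumr_const card_tuple card_bool -mulr_natl mulr1 natrX.
elim: n c => [|n IH] c c0; have [c1|c1] := leP c 1; try exact: trivial_bound.
  by rewrite big1 ?mulr0// => t _; rewrite tuple0 /= leNgt c1.
rewrite (sum_tupleS n (fun t => (crosses c t)%:R)) big_split /= (leNgt c 1) c1 /=.
set A := \sum_(t : n.-tuple bool) _; set B := \sum_(t : n.-tuple bool) _.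
have hA : c / u * A <= 2 ^+ n by apply: IH; rewrite divr_ge0// ltW.
have hB : c / v * B <= 2 ^+ n by apply: IH; rewrite divr_ge0// ltW.
have -> : c * (A + B) = u * (c / u * A) + v * (c / v * B).
  by rewrite mulrDr !mulrA !(mulrC _ c) !mulfK// gt_eqF.
by rewrite exprS -[X in _ <= X * _]uDv mulrDl lerD// ler_pM2l.
Qed.

Lemma card_crossesN_ge n (alpha : R) : 0 < alpha ->
  (1 - alpha) * 2 ^+ n <=
  \sum_(t : n.-tuple bool) (~~ crosses alpha^-1 t)%:R.
Proof.
move=> a0; have /ltW : 0 < alpha^-1 by rewrite invr_gt0.
move=> /(@sum_crosses_le n).
rewrite mulrC ler_pdivrMr// => h.
rewrite (eq_bigr (fun t : n.-tuple bool => 1 - (crosses alpha^-1 t)%:R)); last first.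
  by move=> t _; case: crosses; rewrite ?subrr ?subr0.
rewrite sumrB sumr_const card_tuple card_bool -mulr_natl mulr1 natrX.
by rewrite mulrBl mul1r lerD2l lerN2 mulrC.
Qed.

End coin_betting.

(** * The nulls met along the ordering *)

Section null_path.
Context (R : realType) (p : nat) (H0 : {set 'I_p}).

Definition nulls_in_order (pi : {perm 'I_p}) : seq 'I_p :=
  [seq y <- map pi (enum 'I_p) | y \in H0].

Lemma nulls_in_order_uniq pi : uniq (nulls_in_order pi).
Proof. by rewrite filter_uniq// map_inj_uniq ?enum_uniq//; exact: perm_inj. Qed.

Lemma mem_nulls_in_order pi : nulls_in_order pi =i H0.
Proof.
move=> y; rewrite mem_filter andb_idr// => _.
by apply/mapP; exists (pi^-1%g y); rewrite ?mem_enum ?permKV.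
Qed.

Lemma size_nulls_in_order pi : size (nulls_in_order pi) = #|H0|.
Proof.
rewrite -(card_uniqP (nulls_in_order_uniq pi)).
exact/eq_card/mem_nulls_in_order.
Qed.

Definition first_nulls (pi : {perm 'I_p}) (k : 'I_p) : seq 'I_p :=
  [seq y <- map pi (take k.+1 (enum 'I_p)) | y \in H0].

Lemma first_nulls_prefix pi k : exists l,
  nulls_in_order pi = first_nulls pi k ++ l.
Proof.
exists [seq y <- map pi (drop k.+1 (enum 'I_p)) | y \in H0].
by rewrite -filter_cat -map_cat cat_take_drop.
Qed.

Lemma first_nulls_uniq pi k : uniq (first_nulls pi k).
Proof.
rewrite filter_uniq// map_inj_uniq ?take_uniq ?enum_uniq//; exact: perm_inj.
Qed.

Lemma mem_first_nulls pi k y :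
  (y \in first_nulls pi k) = (y \in H0) && (pi^-1%g y <= k)%N.
Proof.
rewrite mem_filter -{2}(permKV pi y) mem_map; last exact: perm_inj.
congr (_ && _); rewrite -(mem_map val_inj) map_take val_enum_ord.
by rewrite take_iota mem_iota /= add0n leq_min ltnS ltn_ord andbT.
Qed.

Lemma count_first_nulls (f : pred 'I_p) pi k :
  count f (first_nulls pi k) =
  #|[set y : 'I_p | [&& y \in H0, (pi^-1%g y <= k)%N & f y]]%SET|.
Proof.
rewrite -size_filter -(card_uniqP (filter_uniq f (first_nulls_uniq pi k))).
apply: eq_card => y; rewrite mem_filter mem_first_nulls inE. by rewrite andbC andbA.
Qed.

Lemma card_selected_null (w : 'I_p -> R) pi k :
  #|selected w pi k :&: H0| = count (fun y => 0 < w y) (first_nulls pi k).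
Proof.
rewrite count_first_nulls; apply: eq_card => y; rewrite !inE andbC.
congr (_ && _); apply/imsetP/andP => [[j]|[yk wy]].
  by rewrite inE sgr_gt0 => /andP[jk wj] ->; rewrite permK.
by exists (pi^-1%g y); rewrite ?inE ?permKV ?sgr_gt0 ?yk.
Qed.

Lemma count_null_negative_le (w : 'I_p -> R) pi k :
  (forall y, y \in H0 -> w y != 0) ->
  (count (fun y => ~~ (0 < w y)%R) (first_nulls pi k) <=
   num_negative w pi k)%N.
Proof.
move=> w_neq0; rewrite count_first_nulls /num_negative.
rewrite -[X in (_ <= X)%N](card_imset _ (@perm_inj _ pi)).
apply/subset_leq_card/fintype.subsetP => y; rewrite !inE => /and3P[yH yk wy].
apply/imsetP; exists (pi^-1%g y); last by rewrite permKV.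
by rewrite inE yk permKV sgr_lt0 lt_neqAle w_neq0//= leNgt.
Qed.

End null_path.

(** * From the wealth of the gambler to the bound on the FDP *)

Section boundary.
Context (R : realType) (p : nat) (H0 : {set 'I_p}).
Context (a alpha : R) (a_gt0 : 0 < a) (alpha_gt0 : 0 < alpha).
Hypothesis alpha_lt1 : alpha < 1.

Definition loss : R := alpha `^ a^-1.
Definition gain : R := 2 - loss.

Lemma loss_gt0 : 0 < loss. Proof. exact: powR_gt0. Qed.

Lemma loss_lt1 : loss < 1.
Proof.
rewrite /loss -ltr_ln ?posrE ?powR_gt0// ln_powR ln1 pmulr_rlt0 ?invr_gt0//.
by rewrite ln_lt0// alpha_gt0.
Qed.

Lemma gain_gt1 : 1 < gain.
Proof. by have := loss_lt1; rewrite /gain; lra. Qed.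

Lemma gain_gt0 : 0 < gain. Proof. exact: lt_trans ltr01 gain_gt1. Qed.

(** The constants are tuned to this: log loss = log alpha / a, so that on the
    logarithmic scale the level 1/alpha for the wealth is the line
    m log gain = (log (1/alpha) / a) (a + n). *)
Lemma wealth_lt_linear_bound (m n : nat) :
  gain ^+ m * loss ^+ n < alpha^-1 ->
  m%:R < ln alpha^-1 / (a * ln gain) * (a + n%:R).
Proof.
have lng : 0 < ln gain by rewrite ln_gt0// gain_gt1.
rewrite -ltr_ln ?posrE ?mulr_gt0 ?exprn_gt0 ?invr_gt0 ?gain_gt0 ?loss_gt0//.
rewrite lnM ?posrE ?exprn_gt0 ?gain_gt0 ?loss_gt0//.
rewrite !lnXn ?gain_gt0 ?loss_gt0// lnV ?posrE// /loss ln_powR.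
set g := ln gain in lng *; set L := ln alpha => h.
rewrite mulrAC ltr_pdivlMr ?mulr_gt0//.
have -> : m%:R * (a * g) = a * (g *+ m) by rewrite -mulr_natl; ring.
have -> : - L * (a + n%:R) = a * (- L - a^-1 * L *+ n).
  by rewrite -mulr_natl; field; rewrite gt_eqF.
by rewrite ltr_pM2l//; lra.
Qed.

(** The deterministic half of the argument. A zero null statistic would be read
    by the gambler as a negative sign without being counted by
    [num_negative], hence the first hypothesis. *)
Lemma FDP_le_bar (w : 'I_p -> R) (pi : {perm 'I_p}) (k : 'I_p) :
  (forall y, y \in H0 -> w y != 0) ->
  ~~ crosses gain loss alpha^-1 [seq 0 < w y | y <- nulls_in_order H0 pi] ->
  FDP R H0 (selected w pi k) <= FDPbar_knockoff a alpha w pi k.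
Proof.
move=> w_neq0; have [l ->] := first_nulls_prefix H0 pi k.
rewrite map_cat => /(crossesN_prefix gain_gt0 loss_gt0).
rewrite !count_map => /wealth_lt_linear_bound V_lt.
rewrite /FDP /FDPbar_knockoff ler_wpM2r ?invr_ge0// card_selected_null.
rewrite -[_%:R]/((_%:Z)%:~R) ler_int /Vbar_knockoff floor_ge_int.
apply: le_trans (ltW V_lt) _; rewrite ler_wpM2l//.
  rewrite divr_ge0// ?mulr_ge0// ?ltW// ln_gt0 ?gain_gt1//.
  by rewrite invf_gt1.
by rewrite lerD2l ler_nat; exact: count_null_negative_le.
Qed.

End boundary.

(** * Measurability and additivity for finitely many values *)

Section finite_measurability.
Context (d : measure_display) (T : measurableType d) (R : realType).
Context (P : probability T R).

Lemma measurable_preimage_fin (I : finType) (Y : T -> I) (A : set I) :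
  (forall i, measurable (Y @^-1` [set i])) -> measurable (Y @^-1` A).
Proof.
move=> mY; have -> : Y @^-1` A = \bigcup_(i in A) Y @^-1` [set i].
  by apply/seteqP; split => [x Ax|x [i Ai /= ->]]//; exists (Y x).
by apply: fin_bigcup_measurable => //; exact: finite_finset.
Qed.

Lemma probability_fin_bigcup (I : finType) (D : pred I) (F : I -> set T) :
  (forall i, D i -> measurable (F i)) ->
  (forall i j x, F i x -> F j x -> i = j) ->
  P (\bigcup_(i in [set i | D i]) F i) = (\sum_(i | D i) P (F i))%E.
Proof.
move=> mF dF; rewrite measure_fin_bigcup//; last 2 first.
- exact: finite_finset.
- by move=> i j _ _ [x [Fix Fjx]]; exact: dF Fix Fjx.
have -> : [set i | D i] = [set` enum D].
  by apply/seteqP; split => i /=; rewrite mem_enum.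
by rewrite -fsbig_seq ?enum_uniq// big_enum.
Qed.

End finite_measurability.

(** * The joint law of the ordering and the null signs *)

Section knockoffs.
Context (d : measure_display) (T : measurableType d) (R : realType).
Context (P : probability T R) (p : nat) (H0 : {set 'I_p}).
Context (W : 'I_p -> {RV P >-> R}) (hW : knockoff_property W H0).
Context (tau : p.-tuple R -> {perm 'I_p}) (htau : ordering_rule tau).

Definition ranking (x : T) : {perm 'I_p} :=
  magnitude_ordering tau (fun j => W j x).

(** Independence is assumed between sigma-algebras, so the events of the ordering
    have to be placed in the one generated by the magnitudes. It suffices that
    the vector of magnitudes is measurable for that sigma-algebra, since the
    ordering is a Borel function of this vector. *)
Lemma ranking_sigma_magnitude (G : set (set T)) (s : {perm 'I_p}) :
  family_events (magnitude_of W) setT `<=` G ->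
  <<s G >> (ranking @^-1` [set s]).
Proof.
move=> magG.
pose f (x : g_sigma_algebraType G) : p.-tuple R := [tuple magnitude_of W i x | i < p].
have mf : measurable_fun setT f.
  apply/measurable_fun_tnthP => i _ B mB; rewrite setTI.
  apply: sub_sigma_algebra; apply: magG; exists i => //; exists B => //.
  by apply/seteqP; split=> x /=; rewrite tnth_mktuple// => -[].
have := mf measurableT _ (htau.2 s); rewrite setTI; exact.
Qed.

Lemma measurable_ranking (s : {perm 'I_p}) :
  measurable (ranking @^-1` [set s]).
Proof.
have := @ranking_sigma_magnitude _ s (@subset_refl _ _).
apply: (smallest_sub (sigma_algebra_measurable T)).
move=> _ [j _ [B mB <-]].
have mW : measurable_fun setT (magnitude_of W j).
  by apply: measurableT_comp => //; exact: measurable_normr.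
exact: mW.
Qed.

Definition sign_value (b : bool) : R := if b then 1 else -1.

Definition null_signs (b : 'I_p -> bool) : set T :=
  \bigcap_(i in [set` H0]) (sign_of W i @^-1` [set sign_value (b i)]).

Lemma null_signsP b x : null_signs b x ->
  forall i, i \in H0 -> (0 < W i x) = b i /\ W i x != 0.
Proof.
move=> bx i iH; have := bx i iH; rewrite /sign_of /sign_value/= -sgr_gt0 -sgr_eq0.
by move=> ->; case: (b i); rewrite ?ltr01 ?oner_eq0 ?oppr_eq0 ?oner_eq0// ltr0N1.
Qed.

Lemma null_signs_sigma b :
  <<s family_events (sign_of W) [set j | j \in H0] >> (null_signs b).
Proof.
apply: (@fin_bigcap_measurable _
  (g_sigma_algebraType (family_events (sign_of W) [set j | j \in H0]))).
  exact: finite_finset.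
move=> i iH; apply: sub_sigma_algebra; exists i => //.
by exists [set sign_value (b i)] => //; rewrite setTI.
Qed.

Lemma measurable_pos_test i (b : bool) : measurable [set x | (0 < W i x) = b].
Proof.
have : measurable_fun setT (fun x => 0 < W i x) by exact: measurable_fun_ltr.
by move=> /(_ measurableT [set b]); rewrite setTI; apply.
Qed.

Lemma measurable_neg_test i (b : bool) : measurable [set x | (W i x < 0) = b].
Proof.
have : measurable_fun setT (fun x => W i x < 0) by exact: measurable_fun_ltr.
by move=> /(_ measurableT [set b]); rewrite setTI; apply.
Qed.

Lemma measurable_null_signs b : measurable (null_signs b).
Proof.
apply: fin_bigcap_measurable => [|i _]; first exact: finite_finset.
rewrite /sign_of /sign_value; case: (b i).
  rewrite (_ : _ @^-1` _ = [set x | (0 < W i x) = true]).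
    exact: measurable_pos_test.
  by apply/seteqP; split => x /=; [rewrite -sgr_gt0 => ->; rewrite ltr01|move=> /gtr0_sg].
rewrite (_ : _ @^-1` _ = [set x | (W i x < 0) = true]).
  exact: measurable_neg_test.
apply/seteqP; split => x /=; [rewrite -sgr_lt0 => ->|by move=> /ltr0_sg].
by rewrite ltrN10.
Qed.

Lemma probability_null_signs b : P (null_signs b) = (2^-1 ^+ #|H0|)%:E.
Proof.
have [_ indep coin] := hW.
rewrite /null_signs (indep _ (fun i => [set sign_value (b i)]))//.
rewrite (eq_bigr (fun=> (2^-1)%:E)).
  by rewrite prodEFin prodr_const.
move=> i /coin[pos neg]; rewrite /sign_value; case: (b i) => //.
Qed.

Lemma probability_ranking_null_signs s b :
  P (ranking @^-1` [set s] `&` null_signs b) =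
  (P (ranking @^-1` [set s]) * (2^-1 ^+ #|H0|)%:E)%E.
Proof.
have [indep _ _] := hW.
rewrite setIC indep.
- by rewrite probability_null_signs muleC.
- exact: null_signs_sigma.
- by apply: ranking_sigma_magnitude => A mA; left.
Qed.

(** The ordering is y.1 and the null signs, listed in this ordering, are y.2; the
    k-th null of the ordering carries the k-th flip. *)
Definition sign_pattern_event (y : {perm 'I_p} * #|H0|.-tuple bool) : set T :=
  ranking @^-1` [set y.1] `&`
  null_signs (fun i => nth false y.2 (index i (nulls_in_order H0 y.1))).

Lemma sign_pattern_eventP y x : sign_pattern_event y x ->
  [/\ ranking x = y.1,
      [seq 0 < W i x | i <- nulls_in_order H0 y.1] = y.2 &
      forall i, i \in H0 -> W i x != 0].
Proof.
move=> [/= rx /null_signsP bx]; split => //; last by move=> i /bx[].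
apply: (@eq_from_nth _ false) => [|k].
  by rewrite size_map size_nulls_in_order size_tuple.
rewrite size_map => klt; have [i0|no_null] := pickP 'I_p; last first.
  by move: klt; case: (nulls_in_order _ _) => // i; have := no_null i.
rewrite (nth_map i0)// (bx _ _).1; last first.
  by rewrite -(mem_nulls_in_order H0 y.1) mem_nth.
by rewrite index_uniq// nulls_in_order_uniq.
Qed.

Lemma sign_pattern_event_disjoint y z x :
  sign_pattern_event y x -> sign_pattern_event z x -> y = z.
Proof.
move=> /sign_pattern_eventP[ry by_ _] /sign_pattern_eventP[rz bz _].
case: y z ry by_ rz bz => [s b] [s' b'] /= <- bE <- b'E.
by congr pair; apply: val_inj; rewrite /= -bE -b'E.
Qed.

Lemma measurable_sign_pattern_event y : measurable (sign_pattern_event y).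
Proof.
by apply: measurableI; [exact: measurable_ranking|exact: measurable_null_signs].
Qed.

Lemma sum_probability_ranking :
  \sum_s fine (P (ranking @^-1` [set s])) = 1.
Proof.
have : P (\bigcup_(s in [set s | xpredT s]) ranking @^-1` [set s]) = 1%E.
  rewrite (_ : \bigcup_(s in _) _ = setT) ?probability_setT//.
  by apply/seteqP; split => x // _; exists (ranking x).
rewrite probability_fin_bigcup => [|s _|s s' x /= -> ->]//.
  rewrite (eq_bigr (fun s => (fine (P (ranking @^-1` [set s])))%:E)).
    by rewrite sumEFin => -[].
  by move=> s _; rewrite fineK// fin_num_measure//; exact: measurable_ranking.
exact: measurable_ranking.
Qed.

(** The ordering does not affect the law of the flips listed along it: whatever the
    ordering, the sequence of null signs is uniform on the 2^n sequences. *)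
Lemma probability_sign_patterns (D : pred (#|H0|.-tuple bool)) :
  P (\bigcup_(y in [set y | D y.2]) sign_pattern_event y) =
  ((\sum_t (D t)%:R) * 2^-1 ^+ #|H0|)%:E.
Proof.
rewrite (probability_fin_bigcup _ (D := fun y => D y.2)); last 2 first.
- by move=> y _; exact: measurable_sign_pattern_event.
- exact: sign_pattern_event_disjoint.
pose q s := fine (P (ranking @^-1` [set s])).
rewrite (eq_bigr (fun y => (q y.1 * 2^-1 ^+ #|H0|)%:E)); last first.
  move=> y _; rewrite /sign_pattern_event probability_ranking_null_signs EFinM.
  by rewrite fineK// fin_num_measure//; exact: measurable_ranking.
rewrite sumEFin; congr EFin.
rewrite -(pair_big xpredT D (fun s _ => q s * 2^-1 ^+ #|H0|)) /=.
rewrite (eq_bigr (fun s => q s * ((\sum_t (D t)%:R) * 2^-1 ^+ #|H0|))).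
  by rewrite -mulr_suml sum_probability_ranking mul1r.
move=> s _; rewrite big_mkcond mulr_suml mulr_sumr; apply: eq_bigr => t _.
by case: (D t); rewrite ?mul1r// mul0r mulr0.
Qed.

(** The event depends on the sample point only through the ordering and the
    positive and negative index sets, which form a random element Y of a finite
    type with measurable fibres. Its being a union of fibres of Y is expressed
    by its being the preimage of its own image. *)
Lemma measurable_FDP_event (a alpha : R) :
  measurable [set x | forall k,
    FDP R H0 (selected (fun j => W j x) (ranking x) k) <=
    FDPbar_knockoff a alpha (fun j => W j x) (ranking x) k].
Proof.
pose Y x := (ranking x, [ffun j => 0 < W j x], [ffun j => W j x < 0]).
set A := [set x | _]; suff -> : A = Y @^-1` (Y @` A).
  apply: measurable_preimage_fin => -[[s f] g].
  rewrite (_ : _ @^-1` _ = ranking @^-1` [set s] `&`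
    (\bigcap_(j in [set: 'I_p]) [set x | (0 < W j x) = f j]) `&`
    (\bigcap_(j in [set: 'I_p]) [set x | (W j x < 0) = g j])).
    apply: measurableI; first apply: measurableI.
    - exact: measurable_ranking.
    - apply: fin_bigcap_measurable => [|j _]; first exact: finite_finset.
      exact: measurable_pos_test.
    - apply: fin_bigcap_measurable => [|j _]; first exact: finite_finset.
      exact: measurable_neg_test.
  apply/seteqP; split => [x /= [<- <- <-]|x [[/= <- fx] gx]].
    by split=> [|j _ /=]; [split=> // j _ /=|]; rewrite ffunE.
  congr (_, _, _); apply/ffunP => j; rewrite ffunE; [exact: fx|exact: gx].
apply/seteqP; split => [x Ax|x [x' Ax' [rE /ffunP fE /ffunP gE]] k].
  by exists x.
have posE j : (0 < W j x) = (0 < W j x') by have := fE j; rewrite !ffunE.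
have negE j : (W j x < 0) = (W j x' < 0) by have := gE j; rewrite !ffunE.
have := Ax' k; rewrite rE /FDPbar_knockoff /Vbar_knockoff.
have -> : selected (fun j => W j x') (ranking x) k =
          selected (fun j => W j x) (ranking x) k.
  apply/setP => i; apply/imsetP/imsetP => -[j + ->];
  by rewrite inE sgr_gt0 => jP; exists j; rewrite // inE sgr_gt0 ?posE// -posE.
have -> : num_negative (fun j => W j x') (ranking x) k =
          num_negative (fun j => W j x) (ranking x) k.
  by apply: eq_card => j; rewrite !inE !sgr_lt0 negE.
by [].
Qed.

End knockoffs.

(** * The simultaneous bound *)

Theorem corollary1 (d : measure_display) (T : measurableType d) (R : realType)
    (P : probability T R) (p : nat) (H0 : {set 'I_p})
    (W : 'I_p -> {RV P >-> R}) (hW : knockoff_property W H0)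
    (tau : p.-tuple R -> {perm 'I_p}) (htau : ordering_rule tau)
    (a alpha : R) (a_gt0 : 0 < a) (alpha_gt0 : 0 < alpha)
    (alpha_lt1 : alpha < 1) :
  ((1 - alpha)%:E <=
   P [set x : T |
      let w := fun j : 'I_p => W j x in
      let pi := magnitude_ordering tau w in
      forall k : 'I_p,
        (FDP R H0 (selected w pi k) <= FDPbar_knockoff a alpha w pi k)%R])%E.
Proof.
set A := [set x : T | _].
have mA : measurable A by exact: measurable_FDP_event.
pose D (t : #|H0|.-tuple bool) := ~~ crosses (gain a alpha) (loss a alpha) alpha^-1 t.
(* The patterns have nonzero null signs, so they miss a null set of sample
   points. This loses no probability: the flips already have total mass 1. *)
apply: (@le_trans _ _
  (P (\bigcup_(y in [set y | D y.2]) sign_pattern_event W tau y))).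
  rewrite (probability_sign_patterns hW htau D) lee_fin exprVn ler_pdivlMr ?exprn_gt0//.
  apply: card_crossesN_ge => //; first exact: gain_gt0.
    exact: loss_gt0.
  by rewrite /gain subrK.
apply: le_measure; rewrite ?inE//.
  apply: fin_bigcup_measurable => [|y _]; first exact: finite_finset.
  exact: measurable_sign_pattern_event.
move=> x [y Dy /sign_pattern_eventP[rx bE W0]] k.
by apply: FDP_le_bar => //; rewrite -/(ranking W tau x) rx bE.
Qed.
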